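(* Let $f\in\mathbb{Z}[\mathbb{H}]$ be of the form $f=g_1(y,z)x-g_0(y,z)$ with $g_0,g_1\in\mathbb{Z}[y,z]\simeq\mathbb{Z}[\mathbb{Z}^2]$. If for some $m\in\mathbb{Z}$ $$\mathsf{U}(g_1)\cap\{(\xi\chi^m,\chi)\in\mathbb{S}^2:(\xi,\chi)\in\mathsf{U}(g_0)\}\neq\varnothing,$$ then the principal algebraic action $\alpha_f$ on $X_f$ is non-expansive (i.e. not expansive).
   Context: $\mathbb{S}=\{\zeta\in\mathbb{C}:|\zeta|=1\}$. $\mathbb{H}$ is the discrete Heisenberg group of upper triangular unipotent $3\times3$ integer matrices, generated by $x=\begin{pmatrix}1&1&0\\0&1&0\\0&0&1\end{pmatrix}$, $y=\begin{pmatrix}1&0&0\\0&1&1\\0&0&1\end{pmatrix}$, with central element $z=xyx^{-1}y^{-1}$. $\mathbb{Z}[\mathbb{H}]$ is the integer group ring; $\mathbb{Z}[y,z]\simeq\mathbb{Z}[\mathbb{Z}^2]$ means integer Laurent polynomials in the commuting elements $y,z$. For $i=0,1$, $\mathsf{U}(g_i)=\{(\zeta,\chi)\in\mathbb{S}^2:g_i(\zeta,\chi)=0\}$. Let $\mathbb{T}=\mathbb{R}/\mathbb{Z}$. For $f=\sum_\gamma f_\gamma\cdot\gamma\in\mathbb{Z}[\mathbb{H}]$, $X_f=\{v\in\mathbb{T}^{\mathbb{H}}:\sum_{\gamma\in\mathbb{H}}f_\gamma v_{\gamma'\gamma}=0\text{ for every }\gamma'\in\mathbb{H}\}$ and $\alpha_f$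 is the restriction to $X_f$ of the left shift action $(\lambda^\gamma v)_{\gamma'}=v_{\gamma^{-1}\gamma'}$. An action $\alpha$ of a countable group $\Gamma$ by automorphisms of a compact metrisable abelian group $X$, with translation invariant (compatible) metric $d$, is expansive if there is $\varepsilon>0$ with $\sup_{\gamma\in\Gamma}d(\alpha^\gamma v,\alpha^\gamma w)>\varepsilon$ for all distinct $v,w\in X$. *)

(* Defs.v *)
From HB Require Import structures.
From mathcomp Require Import all_boot all_order all_algebra.
From mathcomp Require Import finmap monalg generic_quotient ring_quotient complex.
From mathcomp Require Import all_classical all_reals ereal topology normedtype.
From mathcomp Require Import ring.

Set Implicit Arguments.
Unset Strict Implicit.
Unset Printing Implicit Defensive.

Import Order.TTheory GRing.Theory Num.Theory.
Import numFieldTopology.Exports numFieldNormedType.Exports.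

Local Open Scope classical_set_scope.
Local Open Scope ring_scope.

Definition expgz (G : groupType) (u : G) (n : int) : G :=
  match n with Posz k => (u ^+ k)%g | Negz k => (u ^- k.+1)%g end.

(* The integral group ring of G. The ring structure that [monalg] puts on
   [{malg R[K]}] requires a monoid K without nontrivial units, which excludes
   groups; hence the convolution product below. *)

Definition grpring (G : groupType) : Type := {malg int[G]}.
Bind Scope ring_scope with grpring.

HB.instance Definition _ (G : groupType) :=
  GRing.Zmodule.copy (grpring G) {malg int[G]}.

Section GroupRing.
Local Open Scope fset_scope.
Variable G : groupType.
Implicit Types (f : grpring G) (g h : G).

Definition grpring_elt g : grpring G := << g >>.

Definition grpring_one : grpring G := << 1%g >>.

Definition grpring_mul f1 f2 : grpring G :=
  \sum_(g1 <- msupp f1) \sum_(g2 <- msupp f2)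
     << f1@_g1 * f2@_g2 *g (g1 * g2)%g >>.

Lemma grpring_mulw (d1 d2 : {fset G}) f1 f2 :
  msupp f1 `<=` d1 -> msupp f2 `<=` d2 ->
  grpring_mul f1 f2 = \sum_(g1 <- d1) \sum_(g2 <- d2)
     << f1@_g1 * f2@_g2 *g (g1 * g2)%g >>.
Proof.
move=> le_d1 le_d2; rewrite /grpring_mul (big_fset_incl _ le_d1) /=.
  apply/eq_bigr=> k1 _; apply/big_fset_incl => // k _ /mcoeff_outdom ->.
  by rewrite mulr0 monalgU0.
move=> k _ /mcoeff_outdom g1k.
by rewrite big1 => // k' _; rewrite g1k mul0r monalgU0.
Qed.

Lemma grpring_mul0x : left_zero 0 grpring_mul.
Proof. by move=> f; rewrite /grpring_mul msupp0 big_seq_fset0. Qed.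

Lemma grpring_mulx0 : right_zero 0 grpring_mul.
Proof. by move=> f; rewrite /grpring_mul msupp0 big1// => ? _; rewrite big_seq_fset0. Qed.

Lemma grpring_mulUg c g f : grpring_mul << c *g g >> f =
  \sum_(k <- msupp f) << c * f@_k *g (g * k)%g >>.
Proof.
rewrite (grpring_mulw msuppU_le (fsubset_refl _)) big_seq_fset1.
by apply/eq_bigr => k' _; rewrite mcoeffUU.
Qed.

Lemma grpring_mulgU c g f : grpring_mul f << c *g g >> =
  \sum_(k <- msupp f) << f@_k * c *g (k * g)%g >>.
Proof.
rewrite (grpring_mulw (fsubset_refl _) msuppU_le).
by apply/eq_bigr => k' _; rewrite big_seq_fset1 mcoeffUU.
Qed.

Lemma grpring_mulUU c1 c2 g1 g2 :
  grpring_mul << c1 *g g1 >> << c2 *g g2 >> = << c1 * c2 *g (g1 * g2)%g >>.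
Proof. by rewrite (grpring_mulw msuppU_le msuppU_le) !big_seq_fset1 !mcoeffUU. Qed.

Lemma grpring_mulEl f1 f2 : grpring_mul f1 f2 =
  \sum_(g <- msupp f1) grpring_mul << f1@_g *g g >> f2.
Proof. by apply/eq_bigr=> k _; rewrite grpring_mulUg. Qed.

Lemma grpring_mulEr f1 f2 : grpring_mul f1 f2 =
  \sum_(g <- msupp f2) grpring_mul f1 << f2@_g *g g >>.
Proof.
rewrite /grpring_mul exchange_big; apply/eq_bigr=> k _.
by rewrite -/(grpring_mul _ _) grpring_mulgU.
Qed.

Fact grpring_mul1 : left_id grpring_one grpring_mul.
Proof.
move=> f; rewrite grpring_mulUg [RHS]monalgE.
by apply/eq_bigr=> k _; rewrite mul1r mul1g.
Qed.

Fact grpring_mulr1 : right_id grpring_one grpring_mul.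
Proof.
move=> f; rewrite grpring_mulgU [RHS]monalgE.
by apply/eq_bigr=> k _; rewrite mulr1 mulg1.
Qed.

Fact grpring_mulDl : left_distributive grpring_mul +%R.
Proof.
move=> f1 f2 f; rewrite [in RHS](grpring_mulw (fsubsetUl _ (msupp f2)) (fsubset_refl _)).
rewrite [in RHS](grpring_mulw (fsubsetUr (msupp f1) _) (fsubset_refl _)).
rewrite (grpring_mulw (msuppD_le _ _) (fsubset_refl _)).
rewrite -big_split /=; apply/eq_bigr=> k1 _.
rewrite -big_split /=; apply/eq_bigr=> k2 _.
by rewrite mcoeffD mulrDl monalgUD.
Qed.

Fact grpring_mulDr : right_distributive grpring_mul +%R.
Proof.
move=> f f1 f2; rewrite [in RHS](grpring_mulw (fsubset_refl _) (fsubsetUl _ (msupp f2))).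
rewrite [in RHS](grpring_mulw (fsubset_refl _) (fsubsetUr (msupp f1) _)).
rewrite (grpring_mulw (fsubset_refl _) (msuppD_le _ _)).
rewrite -big_split /=; apply/eq_bigr=> k1 _.
rewrite -big_split /=; apply/eq_bigr=> k2 _.
by rewrite mcoeffD mulrDr monalgUD.
Qed.

Fact grpring_mulA : associative grpring_mul.
Proof.
move=> f1 f2 f3.
rewrite [RHS](big_morph (grpring_mul^~ _) (fun _ _ => grpring_mulDl _ _ _) (grpring_mul0x _)).
rewrite grpring_mulEl; apply/eq_bigr=> k1 _.
rewrite [LHS](big_morph (grpring_mul _) (fun _ _ => grpring_mulDr _ _ _) (grpring_mulx0 _)).
rewrite [RHS](big_morph (grpring_mul^~ _) (fun _ _ => grpring_mulDl _ _ _) (grpring_mul0x _)).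
apply/eq_bigr=> k2 _.
rewrite [LHS](big_morph (grpring_mul _) (fun _ _ => grpring_mulDr _ _ _) (grpring_mulx0 _)).
by rewrite grpring_mulEr; apply/eq_bigr=> k3 _; rewrite !grpring_mulUU mulrA mulgA.
Qed.

Fact grpring_one_neq0 : grpring_one != 0.
Proof. by apply/eqP/malgP=> /(_ 1%g) /eqP; rewrite !mcoeffsE oner_eq0. Qed.

HB.instance Definition _ := GRing.Zmodule_isNzRing.Build (grpring G)
  grpring_mulA grpring_mul1 grpring_mulr1 grpring_mulDl grpring_mulDr
  grpring_one_neq0.

End GroupRing.

(* [is_trig_mx] is lower triangularity. *)
Definition unipotent_upper (A : 'M[int]_3) : bool :=
  is_trig_mx A^T && [forall i, A i i == 1].

Record heisenberg := Heisenberg {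
  heisenberg_mx :> 'M[int]_3;
  heisenberg_mxP : unipotent_upper heisenberg_mx }.

HB.instance Definition _ := [isSub for heisenberg_mx].
HB.instance Definition _ := [Countable of heisenberg by <:].

Section HeisenbergGroup.

Definition hmx (a b c : int) : 'M[int]_3 :=
  1%:M + a *: delta_mx 0 1 + b *: delta_mx 1 2%:R + c *: delta_mx 0 2%:R.

Lemma ord3_ind (P : 'I_3 -> Prop) : P 0 -> P 1 -> P 2%:R -> forall i, P i.
Proof.
move=> P0 P1 P2 [[|[|[|//]]] i3].
- by rewrite (_ : Ordinal i3 = 0) //; apply/val_inj.
- by rewrite (_ : Ordinal i3 = 1) //; apply/val_inj.
- by rewrite (_ : Ordinal i3 = 2%:R) //; apply/val_inj.
Qed.

Lemma unipotent_hmx a b c : unipotent_upper (hmx a b c).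
Proof.
apply/andP; split.
  apply/is_trig_mxP => i j; elim/ord3_ind: i; elim/ord3_ind: j => //= _;
  by rewrite !mxE /= !(mulr0, addr0).
by apply/forallP => i; elim/ord3_ind: i; rewrite !mxE /= !(mulr0, addr0).
Qed.

Lemma hmx_unipotent A : unipotent_upper A ->
  A = hmx (A 0 1) (A 1 2%:R) (A 0 2%:R).
Proof.
case/andP=> /is_trig_mxP tA /forallP dA; apply/matrixP => i j.
have d k : A k k = 1 by apply/eqP/dA.
have t (k l : 'I_3) : (k < l)%N -> A l k = 0 by move=> /tA; rewrite mxE.
elim/ord3_ind: i; elim/ord3_ind: j; rewrite ?d !mxE /= !(mulr0, addr0, mulr1) ?add0r;
  by [|exact: t].
Qed.

Lemma hmxM a b c a' b' c' :
  hmx a b c *m hmx a' b' c' = hmx (a + a') (b + b') (c + c' + a * b').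
Proof.
apply/matrixP => i j; rewrite mxE !big_ord_recl big_ord0.
by elim/ord3_ind: i; elim/ord3_ind: j; rewrite /= !mxE /=; ring.
Qed.

Lemma hmx0 : hmx 0 0 0 = 1%:M.
Proof. by rewrite /hmx !scale0r !addr0. Qed.

Fact heisenberg_oneP : unipotent_upper 1%:M.
Proof. by rewrite -hmx0 unipotent_hmx. Qed.

Fact heisenberg_mulP (A B : heisenberg) : unipotent_upper (A *m B).
Proof.
rewrite (hmx_unipotent (heisenberg_mxP A)) (hmx_unipotent (heisenberg_mxP B)).
by rewrite hmxM unipotent_hmx.
Qed.

Lemma unipotent_inv (A : 'M_3) : unipotent_upper A ->
  A \in unitmx /\ unipotent_upper (invmx A).
Proof.
move=> /hmx_unipotent ->; set a := A _ _; set b := A _ _; set c := A _ _.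
have e : hmx a b c *m hmx (- a) (- b) (a * b - c) = 1%:M.
  by rewrite hmxM -hmx0; congr hmx; ring.
have [u _] := mulmx1_unit e; split => //.
suff -> : invmx (hmx a b c) = hmx (- a) (- b) (a * b - c).
  exact: unipotent_hmx.
by rewrite -[RHS](mulKmx u) e mulmx1.
Qed.

Fact heisenberg_invP (A : heisenberg) : unipotent_upper (invmx A).
Proof. by have [] := unipotent_inv (heisenberg_mxP A). Qed.

Definition heisenberg_one := Heisenberg heisenberg_oneP.
Definition heisenberg_mul A B := Heisenberg (heisenberg_mulP A B).
Definition heisenberg_inv A := Heisenberg (heisenberg_invP A).

Fact heisenberg_mulA : associative heisenberg_mul.
Proof. by move=> A B C; apply/val_inj/mulmxA. Qed.

Fact heisenberg_mul1 : left_id heisenberg_one heisenberg_mul.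
Proof. by move=> A; apply/val_inj/mul1mx. Qed.

Fact heisenberg_mulr1 : right_id heisenberg_one heisenberg_mul.
Proof. by move=> A; apply/val_inj/mulmx1. Qed.

Fact heisenberg_mulV : left_inverse heisenberg_one heisenberg_inv heisenberg_mul.
Proof.
by move=> A; apply/val_inj/mulVmx; have [] := unipotent_inv (heisenberg_mxP A).
Qed.

Fact heisenberg_mulrV : right_inverse heisenberg_one heisenberg_inv heisenberg_mul.
Proof.
by move=> A; apply/val_inj/mulmxV; have [] := unipotent_inv (heisenberg_mxP A).
Qed.

HB.instance Definition _ := isGroup.Build heisenberg heisenberg_mulA
  heisenberg_mul1 heisenberg_mulr1 heisenberg_mulV heisenberg_mulrV.

Fact heisenberg_xP : unipotent_upper (1%:M + delta_mx 0 1).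
Proof.
rewrite (_ : _ + _ = hmx 1 0 0); first exact: unipotent_hmx.
by rewrite /hmx !scale0r !addr0 scale1r.
Qed.

Fact heisenberg_yP : unipotent_upper (1%:M + delta_mx 1 2%:R).
Proof.
rewrite (_ : _ + _ = hmx 0 1 0); first exact: unipotent_hmx.
by rewrite /hmx !scale0r !addr0 scale1r.
Qed.

End HeisenbergGroup.

Definition hx : heisenberg := Heisenberg heisenberg_xP.
Definition hy : heisenberg := Heisenberg heisenberg_yP.
Definition hz : heisenberg := (hx * hy * hx^-1 * hy^-1)%g.

Definition integers (R : realType) : zmodClosed R :=
  GRing.ZmodClosed.clone R (@Num.int_num_subdef R) _.

Definition circle (R : realType) : Type :=
  quotient_topology (Quotient.quot (integers R)).

HB.instance Definition _ (R : realType) := Topological.on (circle R).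
HB.instance Definition _ (R : realType) := Quotient.on (circle R).

Section Circle.
Variable R : realType.
Let Q := Quotient.quot (integers R).

HB.instance Definition _ := GRing.isZmodule.Build (circle R)
  (@addrA Q) (@addrC Q) (@add0r Q) (@addNr Q).

Definition circle_pi (x : R) : circle R := \pi_(circle R)%qT x.

Lemma circle_piB x y : circle_pi (x - y) = circle_pi x - circle_pi y.
Proof. exact: (@pi_is_zmod_morphism _ _ _ Q). Qed.

Lemma circle_pi_eq x y : circle_pi x = circle_pi y <-> x - y \is a Num.int.
Proof.
rewrite -[_ \is a _]/(x - y \in integers R) Quotient.idealrBE.
by split=> [e|/eqP //]; apply/eqP; exact: e.
Qed.

Lemma circle_pi_nbhs (x : R) (A : set R) : nbhs x A -> nbhs (circle_pi x) (circle_pi @` A).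
Proof.
move=> xA; pose B : set (circle R) := circle_pi @` (interior A).
have oB : open B.
  rewrite /open /= /quotient_open.
  have -> : circle_pi @^-1` B = \bigcup_(n in [set n | n \is a Num.int])
      ((fun y => y - n) @^-1` interior A).
    apply/seteqP; split => [y [a Aa ay]|y [n nint Ayn]].
      exists (y - a); first exact/circle_pi_eq/esym.
      by rewrite /= opprB addrC subrK.
    exists (y - n) => //; apply/circle_pi_eq.
    by rewrite addrAC subrr sub0r rpredN.
  apply: bigcup_open => n _; apply: open_comp; last exact: open_interior.
  by move=> y _; apply: continuousB; [exact: cvg_id|exact: cvg_cst].
apply: (@filterS _ _ _ B); first by apply: image_subset; exact: interior_subset.
by apply: open_nbhs_nbhs; split => //; exists x.
Qed.

Fact circle_sub_continuous : continuous (fun a : circle R * circle R => a.1 - a.2).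
Proof.
case=> a b; rewrite -(reprK a) -(reprK b) -!/(circle_pi _).
set x := repr a; set y := repr b => A; rewrite /= -circle_piB => nA.
have pc : continuous circle_pi by exact: (@pi_continuous _ Q).
have /= nA' : nbhs (x - y) (circle_pi @^-1` A) by exact: pc nA.
have /(_ _ nA') := @sub_continuous R^o (x, y).
move=> [[U V] [/= /circle_pi_nbhs Ux /circle_pi_nbhs Vy] UV].
exists (circle_pi @` U, circle_pi @` V) => // -[c d] [/= [u Uu <-] [v Vv <-]] /=.
by rewrite -circle_piB; exact: (UV (u, v)).
Qed.

HB.instance Definition _ :=
  PreTopologicalNmodule_isTopologicalZmodule.Build (circle R) circle_sub_continuous.

End Circle.

Record algebraic_action (G : groupType) (X : topologicalZmodType) :=
  AlgebraicAction {
    action_fun :> G -> X -> X;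
    action1 : forall v, action_fun 1%g v = v;
    actionM : forall g h v, action_fun (g * h)%g v = action_fun g (action_fun h v);
    actionD : forall g, {morph action_fun g : v w / v + w};
    action_continuous : forall g, continuous (action_fun g) }.

Section PrincipalAction.
Variables (R : realType) (G : groupType) (f : grpring G).

Definition principal_group_pred : {pred G -> circle R} := [pred v : G -> circle R |
  `[< forall h : G, \sum_(g <- msupp f) v (h * g)%g *~ f@_g = 0 >] ].

Fact principal_group_closed : zmod_closed principal_group_pred.
Proof.
split=> [|v w]; rewrite !inE.
  by move=> h; apply: big1 => g _; rewrite mul0rz.
move=> v0 w0 h; under eq_bigr do rewrite /= mulrzBl.
by rewrite sumrB v0 w0 subrr.
Qed.

HB.instance Definition _ :=
  GRing.isZmodClosed.Build (G -> circle R) principal_group_pred principal_group_closed.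

(* The group structure is inherited from the pointwise one on [G -> circle R],
   the topology from the product topology. *)
Record principal_group := PrincipalGroup {
  principal_val :> G -> circle R;
  principal_valP : principal_val \in principal_group_pred }.

HB.instance Definition _ := [isSub for principal_val].
HB.instance Definition _ := [Choice of principal_group by <:].
HB.instance Definition _ := [SubChoice_isSubZmodule of principal_group by <:].

Definition principal_ptws (v : principal_group) : {ptws G -> circle R} := principal_val v.

HB.instance Definition _ :=
  Topological.copy principal_group (initial_topology principal_ptws).

Lemma principal_eval_continuous (h : G) : continuous (fun v : principal_group => v h).
Proof.
move=> v; apply: (@continuous_comp _ {ptws G -> circle R} _ principal_ptws
  (@proj G (fun=> circle R) h)).
  exact: initial_continuous.
exact: proj_continuous.
Qed.

Lemma continuous_to_principal (T : topologicalType) (F : T -> principal_group) :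
  (forall h, continuous (fun t => F t h)) -> continuous F.
Proof.
move=> cF; apply: continuous_comp_initial => t.
apply/cvg_sup => h; apply: (continuous_comp_initial (Y := {ptws G -> circle R})).
exact: cF.
Qed.

Fact principal_sub_continuous :
  continuous (fun a : principal_group * principal_group => a.1 - a.2).
Proof.
apply: continuous_to_principal => h a /=.
apply: (continuous_comp (f := fun b : principal_group * principal_group =>
  (b.1 h, b.2 h)) (g := fun c : circle R * circle R => c.1 - c.2)); last first.
  exact: sub_continuous.
have c1 : principal_val b.1 h @[b --> a] --> principal_val a.1 h.
  by apply: (continuous_comp (f := fst)
    (g := fun v : principal_group => v h)); [exact: cvg_fst|exact: principal_eval_continuous].
have c2 : principal_val b.2 h @[b --> a] --> principal_val a.2 h.
  by apply: (continuous_comp (f := snd)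
    (g := fun v : principal_group => v h)); [exact: cvg_snd|exact: principal_eval_continuous].
exact: cvg_pair c1 c2.
Qed.

HB.instance Definition _ :=
  PreTopologicalNmodule_isTopologicalZmodule.Build principal_group
    principal_sub_continuous.

Fact left_shiftP (g : G) (v : principal_group) :
  (fun h : G => v (g^-1 * h)%g) \in principal_group_pred.
Proof.
have := principal_valP v; rewrite !inE => v0 h.
by under eq_bigr do rewrite mulgA; exact: v0.
Qed.

Definition left_shift g v := PrincipalGroup (left_shiftP g v).

Fact left_shift1 v : left_shift 1%g v = v.
Proof. by apply/val_inj/funext => h /=; rewrite invg1 mul1g. Qed.

Fact left_shiftM g h v : left_shift (g * h)%g v = left_shift g (left_shift h v).
Proof. by apply/val_inj/funext => k /=; rewrite invgM mulgA. Qed.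

Fact left_shiftD g : {morph left_shift g : v w / v + w}.
Proof. by move=> v w; apply/val_inj/funext => k. Qed.

Fact left_shift_continuous g : continuous (left_shift g).
Proof. by apply: continuous_to_principal => h; exact: principal_eval_continuous. Qed.

Definition principal_action : algebraic_action G principal_group :=
  AlgebraicAction left_shift1 left_shiftM left_shiftD left_shift_continuous.

End PrincipalAction.

(* Nonnegativity follows from the first three conditions; the last one says
   that d induces the given topology of X. *)
Record invariant_metric (R : realType) (X : topologicalZmodType)
    (d : X -> X -> R) : Prop := InvariantMetric {
  metric_eq0 : forall v w, d v w = 0 <-> v = w;
  metric_sym : forall v w, d v w = d w v;
  metric_triangle : forall v w u, d v u <= d v w + d w u;
  metric_translation : forall v w u, d (v + u) (w + u) = d v w;
  metric_nbhs : forall v (A : set X),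
    nbhs v A <-> exists2 e : R, 0 < e & [set w | d v w < e] `<=` A }.

(* The supremum is taken in the extended reals, since d is not assumed to be
   bounded. Any two such metrics are uniformly equivalent, so the property does
   not depend on the choice of d. *)
Definition expansive (R : realType) (G : groupType) (X : topologicalZmodType)
    (d : X -> X -> R) (alpha : algebraic_action G X) : Prop :=
  exists2 e : R, 0 < e & forall v w : X, v <> w ->
    (e%:E < ereal_sup [set (d (alpha g v) (alpha g w))%:E | g in [set: G]])%E.

(* The index (a, b) stands for the monomial y^a z^b. *)
Definition laurent2 : Type := {malg int[(int * int)%type]}.

Definition laurent2_eval (R : rcfType) (g : laurent2) (zeta chi : R[i]) : R[i] :=
  \sum_(k <- msupp g) (g@_k)%:~R * zeta ^ k.1 * chi ^ k.2.

Definition laurent2_grpring (g : laurent2) : grpring heisenberg :=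
  \sum_(k <- msupp g) << g@_k *g (expgz hy k.1 * expgz hz k.2)%g >>.

Definition unitary_variety (R : rcfType) (g : laurent2) : set (R[i] * R[i]) :=
  [set p | [/\ `|p.1| = 1, `|p.2| = 1 & laurent2_eval g p.1 p.2 = 0]].

Arguments unitary_variety : clear implicits.

(* Main.v *)
(** Let (a, b, c) be the entries (1,2), (2,3), (1,3) of a matrix in the Heisenberg
    group. Functions phi(a) w^b chi^c are mapped by f to functions of the same
    shape, phi(a) being replaced with
    phi(a+1) g1(w chi^a, chi) - phi(a) g0(w chi^a, chi). By hypothesis
    g0(xi, chi) = 0 = g1(xi chi^m, chi). As chi is recurrent, some N > m gives
    g1(xi chi^(m-N), chi) close to 0; starting from w = xi chi^(m-N), the
    recurrence is cut off almost exactly at a = 0 and exactly at a = N - m > 0,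
    and has a finitely supported solution in between. After normalizing and
    translating so that the maximum of |phi| is 1 and is reached at the identity,
    real parts give bounded almost kernel functions of f, and an ultralimit makes
    the error vanish. Small multiples of the resulting bounded real function
    project to nonzero points of X_f with uniformly small orbits. *)

Require Import Defs.
From HB Require Import structures.
From mathcomp Require Import all_boot all_order all_algebra.
From mathcomp Require Import finmap monalg complex.
From mathcomp Require Import all_classical all_reals ereal topology normedtype.
From mathcomp Require Import generic_quotient ring_quotient zify ring lra.
Import Order.TTheory GRing.Theory Num.Theory.
Import numFieldTopology.Exports numFieldNormedType.Exports.
Local Open Scope classical_set_scope.
Local Open Scope ring_scope.

Set Implicit Arguments.
Unset Strict Implicit.
Unset Printing Implicit Defensive.

(** * Pairing of group ring elements with functions on the group *)

Section Pairing.
Local Open Scope fset_scope.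

(** Applied to [g |-> v (h * g)], this is the sum defining [principal_group_pred]. Values in any
    abelian group are allowed so that kernel conditions pass from complex to real to circle-valued
    functions by [grp_pair_comp]. *)
Definition grp_pair (G : groupType) (V : zmodType) (f : grpring G) (v : G -> V) : V :=
  \sum_(g <- msupp f) v g *~ f@_g.

Variables (G : groupType) (V : zmodType).
Implicit Types (f : grpring G) (v : G -> V).

Lemma grp_pairw (d : {fset G}) f v : msupp f `<=` d ->
  grp_pair f v = \sum_(g <- d) v g *~ f@_g.
Proof.
move=> fd; rewrite /grp_pair (big_fset_incl _ fd) //= => g _ /mcoeff_outdom ->.
by rewrite mulr0z.
Qed.

Lemma grp_pair0 v : grp_pair 0%R v = 0%R.
Proof. by rewrite /grp_pair msupp0 big_seq_fset0. Qed.

Lemma grp_pairB f1 f2 v : grp_pair (f1 - f2)%R v = (grp_pair f1 v - grp_pair f2 v)%R.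
Proof.
rewrite (grp_pairw v (msuppB_le f1 f2)).
rewrite (grp_pairw v (fsubsetUl (msupp f1) (msupp f2))).
rewrite (grp_pairw v (fsubsetUr (msupp f1) (msupp f2))) -sumrB.
by apply/eq_bigr => g _; rewrite mcoeffB mulrzBr.
Qed.

Lemma grp_pairD f1 f2 v : grp_pair (f1 + f2)%R v = (grp_pair f1 v + grp_pair f2 v)%R.
Proof.
by rewrite -[f1 in RHS](addrK f2) grp_pairB subrK.
Qed.

Lemma grp_pairU c g v : grp_pair << c *g g >> v = v g *~ c.
Proof. by rewrite (grp_pairw v msuppU_le) big_seq_fset1 mcoeffUU. Qed.

Lemma grp_pair_sum (I : Type) (r : seq I) (F : I -> grpring G) v :
  grp_pair (\sum_(i <- r) F i) v = \sum_(i <- r) grp_pair (F i) v.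
Proof.
apply: (big_morph (fun f => grp_pair f v)); last exact: grp_pair0.
by move=> f1 f2; exact: grp_pairD.
Qed.

Lemma grp_pair_comp (W : zmodType) (phi : {additive V -> W}) f v :
  grp_pair f (phi \o v) = phi (grp_pair f v).
Proof. by rewrite raddf_sum; apply/eq_bigr => g _; rewrite raddfMz. Qed.

End Pairing.

HB.instance Definition _ (R : realType) :=
  GRing.isZmodMorphism.Build R (circle R) (@circle_pi R) (@circle_piB R).

(** * Ultralimits of bounded real functions *)

Section Ultralimit.
Variables (R : realType) (T : Type) (U : set_system T).
Hypothesis UU : UltraFilter U.

(** Compactness of [[- b, b]] yields a cluster point, and an ultrafilter converges to its cluster
    points. *)
Lemma ultra_bounded_cvg (u : T -> R) (b : R) :
  (forall t, `|u t| <= b) -> exists2 p : R, u @ U --> p & `|p| <= b.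
Proof.
move=> ub; have : (u @ U) `[- b, b]%classic.
  by apply: (@filterE _ U) => t; rewrite /= in_itv /= -ler_norml.
move=> /(@segment_compact R (- b) b _ _)[p [+ clp]].
rewrite /= in_itv /= -ler_norml => pb; exists p => // A pA.
have [//|nA] := in_ultra_setVsetC (u @^-1` A) UU.
by have [x [/= nx /nx]] := clp (~` A) A nA pA.
Qed.

End Ultralimit.

(** * From almost kernel functions to non-expansiveness *)

Section Nonexpansive.
Variables (R : realType) (G : groupType) (f : grpring G).

(** Take pointwise limits along an ultrafilter finer than [\oo]. The pairing is a finite sum, so it
    commutes with the limit; the value 1 at the identity keeps the limit nonzero. *)
Lemma almost_kernel_kernel :
  (forall n : nat, exists v : G -> R, [/\ forall g, `|v g| <= 1, v 1%g = 1 &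
     forall h, `|grp_pair f (fun g => v (h * g)%g)| <= n.+1%:R^-1]) ->
  exists v : G -> R, [/\ forall g, `|v g| <= 1, v 1%g = 1 &
     forall h, grp_pair f (fun g => v (h * g)%g) = 0].
Proof.
move=> /choice[v vP].
have [U [UU oU]] := @ultraFilterLemma nat \oo _.
have /choice[u uP] : forall g, exists p : R,
    (fun n => v n g) @ U --> p /\ `|p| <= 1.
  move=> g; have [|p] := @ultra_bounded_cvg _ _ _ UU (fun n => v n g) 1.
    by move=> n; case: (vP n).
  by exists p.
exists u; split=> [g|| h]; first by case: (uP g).
- have [u1 _] := uP 1%g; have v1 : (fun n => v n 1%g) @ U --> (1 : R).
    rewrite (_ : (fun n => v n 1%g) = cst 1); first exact: cvg_cst.
    by apply/funext => n; case: (vP n).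
  have Un := @cvg_unique R (@Rhausdorff R) (fmap (fun n => v n 1%g) U).
  exact: Un u1 v1.
- pose w n := grp_pair f (fun g => v n (h * g)%g).
  have wu : w @ U --> grp_pair f (fun g => u (h * g)%g).
    rewrite /w /grp_pair; apply: cvg_big => [|g _]; first exact: add_continuous.
    under eq_fun do rewrite -mulrzr.
    by rewrite -mulrzr; apply: cvgMr_tmp; case: (uP (h * g)%g).
  have w0 : w @ U --> (0 : R).
    have w0 : w @ \oo --> (0 : R).
      apply/cvgrPdist_le => e e0; near=> n.
      rewrite sub0r normrN; case: (vP n) => _ _ /(_ h) /le_trans -> //.
      by apply/ltW; near: n; exact: (near_infty_natSinv_lt (PosNum e0)).
    by apply: cvg_trans w0; move=> A; exact: oU.
  exact: (@cvg_unique R (@Rhausdorff R) (fmap w U) _ _ _ wu w0).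
Unshelve. all: by end_near.
Qed.

(** Uniform smallness controls every coordinate, so the filter generated by the sets [S r] converges
    to 0 in the product topology, as is checked one coordinate at a time. *)
Lemma small_principal_nbhs (A : set (principal_group R f)) :
  nbhs (0 : principal_group R f) A ->
  exists2 r : R, 0 < r & forall w : principal_group R f,
    (forall h, exists2 x : R, `|x| <= r & w h = circle_pi x) -> A w.
Proof.
pose S (r : R) := [set w : {ptws G -> circle R} |
  forall h, exists2 x : R, `|x| <= r & w h = circle_pi x].
pose F := filter_from [set r : R | 0 < r] S.
have FF : ProperFilter F.
  apply: filter_from_proper; last first.
    by move=> r /= r0; exists (fun=> circle_pi 0) => h; exists 0; rewrite ?normr0 ?ltW.
  apply: filter_from_filter; first by exists 1 => /=.
  move=> r s /= r0 s0; exists (Num.min r s); first by rewrite /= lt_min r0.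
  move=> w wS; split=> h; have [x + ->] := wS h; rewrite le_min => /andP[xr xs];
    by exists x.
have F0 : F --> (principal_ptws (0 : principal_group R f)).
  apply/cvg_sup => h B.
  case=> C [[D oD <-] Dh] /filterS; apply.
  have : nbhs (0 : R) (@circle_pi R @^-1` D).
    have pc : continuous (@circle_pi R) by exact: (@pi_continuous _ (Quotient.quot (integers R))).
    by apply: pc; apply: open_nbhs_nbhs; split => //; rewrite raddf0.
  move=> /nbhs_norm0P[e /= e0 eD]; exists (e / 2); first by rewrite /= divr_gt0.
  move=> w /(_ h)[x xe wx]; rewrite /= /proj wx; apply: eD => /=.
  by rewrite (le_lt_trans xe)// ltr_pdivrMr// ltr_pMr// ltr1n.
case=> B [[C oC <-] C0] CA.
have [r r0 rC] := F0 _ (open_nbhs_nbhs (conj oC C0)).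
by exists r => // w wr; apply: CA; apply: rC.
Qed.

(** Shifts only permute the values of a point, so the whole orbit of the projection of [t * u] is as
    uniformly small as the point itself. *)
Lemma bounded_kernel_nonexpansive (d : principal_group R f -> principal_group R f -> R)
    (u : G -> R) (g0 : G) :
  invariant_metric d -> (forall g, `|u g| <= 1) -> u g0 != 0 ->
  (forall h, grp_pair f (fun g => u (h * g)%g) = 0) ->
  ~ expansive d (principal_action R f).
Proof.
move=> hd u1 u0 uker [e e0 exp].
have [|r r0 small] := @small_principal_nbhs [set w | d 0 w < e].
  by apply/(metric_nbhs hd); exists e.
(* The bound [r] keeps the orbit in the [e]-ball around 0; the bound [1 / 2] prevents the nonzero
   number [t * u g0] from being an integer. *)
pose t := Num.min r (1 / 2).
have t0 : 0 < t by rewrite lt_min r0 divr_gt0.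
have tP : (fun g => circle_pi (t * u g)) \in principal_group_pred f.
  rewrite inE => h.
  have tu0 : grp_pair f (fun g => t * u (h * g)%g) = 0.
    by rewrite -(mulr0 t) -(uker h) mulr_sumr; apply: eq_bigr => g _; rewrite mulrzAr.
  by have := grp_pair_comp (@circle_pi R) f (fun g => t * u (h * g)%g); rewrite tu0 raddf0.
pose w := PrincipalGroup tP.
have w0 : 0 <> w.
  move=> /(congr1 (fun v : principal_group R f => v g0)) /= /esym.
  rewrite -[RHS](raddf0 (@circle_pi R)) => /circle_pi_eq; rewrite subr0 => /intrP[k tk].
  have : `|t * u g0| < 1.
    rewrite normrM (le_lt_trans (ler_piMr _ (u1 g0)))// gtr0_norm//.
    by rewrite gt_min ltr_pdivrMr// mul1r ltr1n orbT.
  rewrite tk -intr_norm ltrz1.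
  have : k != 0 by rewrite -(intr_eq0 R) -tk mulf_neq0// gt_eqF.
  by rewrite -normr_gt0; lia.
have := exp 0 w w0; apply/negP; rewrite -leNgt.
apply: ge_ereal_sup => _ [g _ <-]; rewrite lee_fin ltW//.
have -> : principal_action R f g 0 = 0 by apply/val_inj/funext.
apply: small => h; exists (t * u (g^-1 * h)%g) => //.
rewrite normrM (le_trans (ler_piMr _ (u1 _)))// gtr0_norm//.
by rewrite ge_min lexx.
Qed.

End Nonexpansive.

(** * Estimates on the complex unit circle *)

Section Complex.
Variable R : rcfType.
Local Open Scope complex_scope.

Lemma normc_ge_Im (x : R[i]) : `|complex.Im x|%:C <= `|x|.
Proof.
case: x => a b; rewrite normc_def lecR -sqrtr_sqr.
by apply: ler_wsqrtr; rewrite lerDr sqr_ge0.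
Qed.

Lemma normc_le_ReIm (x : R[i]) : `|x| <= (`|complex.Re x| + `|complex.Im x|)%:C.
Proof.
rewrite normc_def lecR -[leRHS]ger0_norm ?addr_ge0// -[leRHS]sqrtr_sqr.
apply: ler_wsqrtr; rewrite sqrrD !real_normK ?num_real// -addrA [X in _ <= _ + X]addrC addrA.
by rewrite lerDl mulrn_wge0// mulr_ge0.
Qed.

(** For [n >= 0], [u ^ n - 1] is [u - 1] times a sum of [n] terms of modulus 1. Multiplying by
    [u ^ n] reduces the exponent [- n] to [n]. *)
Lemma normrXz_sub1 (u : R[i]) (k : int) : `|u| = 1 -> `|u ^ k - 1| <= `|k|%:~R * `|u - 1|.
Proof.
move=> u1; have nat_case n : `|u ^+ n - 1| <= n%:R * `|u - 1|.
  rewrite subrX1 normrM mulrC ler_wpM2r// (le_trans (ler_norm_sum _ _ _))//.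
  rewrite -[X in _ <= X%:R]card_ord -sum1_card natr_sum ler_sum// => i _.
  by rewrite normrX u1 expr1n.
have u0 : u != 0 by rewrite -normr_gt0 u1.
case: k => n; first exact: nat_case.
have un1 : `|u ^+ n.+1| = 1 by rewrite normrX u1 expr1n.
have <- : `|u ^+ n.+1 - 1| = `|u ^ Negz n - 1|.
  by rewrite -[RHS]mul1r -[X in X * _]un1 -normrM mulrBr mulr1 divff ?expf_neq0// distrC.
exact: nat_case.
Qed.

Lemma normrXz1 (u : R[i]) (k : int) : `|u| = 1 -> `|u ^ k| = 1.
Proof.
move=> u1; case: k => n;
  by rewrite ?normrV ?unitfE ?expf_neq0 -?normr_gt0 ?u1// normrX u1 expr1n ?invr1.
Qed.

(** [K] does not depend on [u], so it can be fixed before the power of [chi] playing the role of [u]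
    is chosen. *)
Lemma laurent2_eval_perturb (g : laurent2) : exists2 K : R, 0 <= K &
  forall w u c : R[i], `|w| = 1 -> `|u| = 1 -> `|c| = 1 ->
  `|laurent2_eval g (w * u) c - laurent2_eval g w c| <= K%:C * `|u - 1|.
Proof.
exists (\sum_(k <- msupp g) `|g@_k|%:~R * `|k.1|%:~R).
  by apply: sumr_ge0 => k _; rewrite mulr_ge0// ler0z.
move=> w u c w1 u1 c1; rewrite -sumrB (le_trans (ler_norm_sum _ _ _))//.
rewrite rmorph_sum /= mulr_suml ler_sum// => k _.
rewrite expfzMl -mulrBl normrM normrXz1// mulr1 -mulrBr normrM.
rewrite -[X in _ - X]mulr1 -mulrBr normrM normrXz1// mul1r rmorphM/= !rmorph_int.
by rewrite -intr_norm -mulrA ler_wpM2l ?ler0z// normrXz_sub1.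
Qed.

End Complex.

Section Recurrence.
Variable R : realType.
Local Open Scope complex_scope.

(* Along an ultrafilter finer than [\oo] the powers of c converge, so two of them
   with distant exponents are close. *)
Lemma unit_circle_recurrence (c : R[i]) (e : R) (M : nat) :
  `|c| = 1 -> 0 < e -> exists2 N : nat, (M <= N)%N & `|c ^+ N - 1| <= e%:C.
Proof.
move=> c1 e0; have [U [UU oU]] := @ultraFilterLemma nat \oo _.
have cn1 n : `|c ^+ n| = 1 by rewrite normrX c1 expr1n.
have [n|p pP _] := @ultra_bounded_cvg R _ _ UU (fun n => complex.Re (c ^+ n)) 1.
  by rewrite -lecR (le_trans (normc_ge_Re _))// cn1.
have [n|q qP _] := @ultra_bounded_cvg R _ _ UU (fun n => complex.Im (c ^+ n)) 1.
  by rewrite -lecR (le_trans (normc_ge_Im _))// cn1.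
(* Real and imaginary parts at each of two exponents give four deviations. *)
have e4 : 0 < e / 4 by rewrite divr_gt0.
move/cvgrPdist_lt: pP => /(_ _ e4) pP; move/cvgrPdist_lt: qP => /(_ _ e4) qP.
have FU : Filter U by exact: _.
have Un := @filterI _ U FU _ _ pP qP.
have [n [/= pn qn]] := @filter_ex _ U _ _ Un.
have [n' [[/= pn' qn'] /= nn']] := @filter_ex _ U _ _
  (@filterI _ U FU _ _ Un (oU _ (nbhs_infty_ge (n + M)))).
have nle : (n <= n')%N by rewrite (leq_trans _ nn')// leq_addr.
exists (n' - n)%N; first by rewrite leq_subRL.
rewrite -[leLHS]mul1r -[X in X * _](cn1 n) -normrM mulrBr mulr1 -exprD subnKC//.
rewrite (le_trans (normc_le_ReIm _))// lecR !raddfB /=.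
move: pn qn pn' qn'; set a := complex.Re _; set b := complex.Im _.
set a' := complex.Re _; set b' := complex.Im _ => pn qn pn' qn'.
have := ler_distD p a' a; have := ler_distD q b' b.
by rewrite (distrC a' p) (distrC b' q); lra.
Qed.

End Recurrence.

(** * Finitely supported solutions of the recurrence *)

Section Chain.
Variable R : rcfType.
Local Open Scope complex_scope.

Lemma normc_argmax (n : nat) (phi : nat -> R[i]) :
  exists2 k, (k <= n)%N & forall j, (j <= n)%N -> `|phi j| <= `|phi k|.
Proof.
elim: n => [|n [k kn kmax]].
  by exists 0%N => // j; rewrite leqn0 => /eqP ->.
have [le|lt] := real_leP (normr_real (phi n.+1)) (normr_real (phi k)).
  exists k; first exact: leqW.
  by move=> j; rewrite leq_eqVlt => /predU1P[->|/kmax].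
exists n.+1 => // j; rewrite leq_eqVlt => /predU1P[->//|/kmax le].
exact: le_trans le (ltW lt).
Qed.

(** A solution supported on [1..L] satisfies the recurrence exactly except at [a = 0], where the
    error is a multiple of [P 0]. Dividing by the value of largest modulus makes that multiple at
    most 1 in modulus. *)
Lemma almost_recurrence_solution (P Q : int -> R[i]) (L : nat) (e : R) :
  (0 < L)%N -> Q L = 0 -> `|P 0| <= e%:C ->
  exists (phi : int -> R[i]) (a0 : int), [/\ phi a0 = 1, forall a, `|phi a| <= 1 &
    forall a, `|phi (a + 1) * P a - phi a * Q a| <= e%:C].
Proof.
move=> L0 QL P0.
(* Minimality of [L] makes [psi L], a product of earlier values of [Q], nonzero. *)
have [{L0 QL}L /andP[L0 /eqP QL] Lmin] :=
  ex_minnP (ex_intro (fun L : nat => (0 < L)%N && (Q L == 0)) L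
    (introT andP (conj L0 (introT eqP QL)))).
(* The solution by successive quotients [Q j / P j], cleared of denominators because [P] may
   vanish. *)
pose psi (k : nat) := if (0 < k <= L)%N then
  \prod_(1 <= j < k) Q j * \prod_(k <= j < L) P j else 0.
have psiL : psi L != 0.
  rewrite /psi L0 leqnn [X in _ * X]big_geq// mulr1 prodf_seq_neq0.
  apply/allP => j; rewrite mem_index_iota => /andP[j1 jL].
  apply/eqP => /eqP Qj; have := Lmin j; rewrite j1 Qj => /(_ isT).
  by rewrite leqNgt jL.
have [k kL kmax] := normc_argmax L psi.
have psik : psi k != 0.
  by rewrite -normr_gt0 (lt_le_trans _ (kmax L (leqnn L)))// normr_gt0.
have psi_le j : `|psi j / psi k| <= 1.
  rewrite normf_div ler_pdivrMr ?normr_gt0// mul1r.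
  have [/kmax//|Lj] := leqP j L.
  by rewrite {1}/psi (leqNgt j) Lj andbF normr0.
have e0 : 0 <= e%:C by apply: le_trans P0.
exists (fun a => if a is Posz j then psi j / psi k else 0), k; split.
- by rewrite divff.
- by case=> // j; rewrite normr0.
case=> [j|[|j]]; last first.
- by rewrite NegzE (_ : - _ + 1 = Negz j)// ?mul0r ?subr0 ?normr0//; lia.
- by rewrite /= {1}/psi /= !mul0r subr0 normr0.
rewrite -PoszD addn1; have [->|j0] := posnP j.
  by rewrite {2}/psi /= !mul0r subr0 normrM -[e%:C]mul1r ler_pM.
rewrite mulrAC [X in _ - X]mulrAC -mulrBl.
suff -> : psi j.+1 * P j - psi j * Q j = 0 by rewrite mul0r normr0.
(* Inside the support both products agree; beyond [L] both terms vanish; at [L] the cutoff kills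
   [psi j.+1] and [Q L = 0] kills the other term. *)
rewrite /psi j0 /=; have [jL|Lj|->] := ltngtP j L.
- rewrite (@big_nat_recr _ _ _ j)//= (@big_ltn _ _ _ j)//; ring.
- by rewrite !mul0r subrr.
- by rewrite QL mulr0 mul0r subrr.
Qed.

End Chain.

(** * Coordinates on the Heisenberg group *)

Definition heis (a b c : int) : heisenberg := Heisenberg (unipotent_hmx a b c).

Lemma heisE (h : heisenberg) : h = heis (h 0 1) (h 1 2%:R) (h 0 2%:R).
Proof. by apply/val_inj/hmx_unipotent/heisenberg_mxP. Qed.

Lemma heis_entries a b c :
  (heis a b c 0 1 = a) * (heis a b c 1 2%:R = b) * (heis a b c 0 2%:R = c).
Proof. by rewrite /= !mxE /= !(mulr0, mulr1, addr0, add0r). Qed.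

Lemma heisM a b c a' b' c' :
  (heis a b c * heis a' b' c')%g = heis (a + a') (b + b') (c + c' + a * b').
Proof. by apply/val_inj/hmxM. Qed.

Lemma heis1 : heis 0 0 0 = 1%g.
Proof. by apply/val_inj/hmx0. Qed.

Lemma heisV a b c : (heis a b c)^-1%g = heis (- a) (- b) (a * b - c).
Proof. by apply/esym/divg1_eq; rewrite invgK heisM -heis1; congr heis; ring. Qed.

Lemma hxE : hx = heis 1 0 0.
Proof. by apply/val_inj; rewrite /= /hmx !scale0r !addr0 scale1r. Qed.

Lemma hyE : hy = heis 0 1 0.
Proof. by apply/val_inj; rewrite /= /hmx !scale0r !addr0 scale1r. Qed.

Lemma hzE : hz = heis 0 0 1.
Proof. by rewrite /hz hxE hyE !heisV !heisM; congr heis; ring. Qed.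

Lemma expgz_heis b c n : expgz (heis 0 b c) n = heis 0 (n * b) (n * c).
Proof.
have nat_case k : (heis 0 b c ^+ k)%g = heis 0 (k%:Z * b) (k%:Z * c).
  elim: k => [|k IH]; first by rewrite expg0 !mul0r heis1.
  by rewrite expgS IH heisM; congr heis; rewrite ?intS; ring.
case: n => k /=; first exact: nat_case.
by rewrite nat_case heisV NegzE; congr heis; ring.
Qed.

Lemma hyz_expgz j l : (expgz hy j * expgz hz l)%g = heis 0 j l.
Proof. by rewrite hyE hzE !expgz_heis heisM; congr heis; ring. Qed.

(** * Action of [f] on waves *)

Section Character.
Variable R : rcfType.
Variables (phi : int -> R[i]) (w c : R[i]).
Hypotheses (w0 : w != 0) (c0 : c != 0).

Definition heis_wave (h : heisenberg) : R[i] := phi (h 0 1) * w ^ (h 1 2%:R) * c ^ (h 0 2%:R).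

(** Right multiplication by [y^j z^l] multiplies a wave by [(w * c ^ a) ^ j * c ^ l], the twist
    [c ^ a] coming from the term [a * b'] in [heisM]. A further factor [hx] only raises [a] by 1. *)
Lemma grp_pair_heis_wave (g0 g1 : laurent2) (h : heisenberg) :
  grp_pair (laurent2_grpring g1 * grpring_elt hx - laurent2_grpring g0)
    (fun g => heis_wave (h * g)%g) =
  w ^ (h 1 2%:R) * c ^ (h 0 2%:R) *
    (phi (h 0 1 + 1) * laurent2_eval g1 (w * c ^ (h 0 1)) c
     - phi (h 0 1) * laurent2_eval g0 (w * c ^ (h 0 1)) c).
Proof.
rewrite grp_pairB mulr_suml !grp_pair_sum /laurent2_eval [h]heisE.
move: (h 0 1) (h 1 2%:R) (h 0 2%:R) => a b d {h}; rewrite !heis_entries.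
rewrite mulrBr !mulr_sumr; congr (_ - _); apply: eq_bigr => -[j l] _ /=.
- rewrite [_ * grpring_elt hx]grpring_mulUU mulr1 grp_pairU hyz_expgz hxE !heisM.
  rewrite /heis_wave !heis_entries -mulrzr expfzMl exprz_exp.
  rewrite !(expfzDr _ _ w0) !(expfzDr _ _ c0) !(mul0r,mulr0,addr0,add0r); ring.
- rewrite grp_pairU hyz_expgz !heisM.
  rewrite /heis_wave !heis_entries -mulrzr expfzMl exprz_exp.
  rewrite !(expfzDr _ _ w0) !(expfzDr _ _ c0) !(mul0r,mulr0,addr0,add0r); ring.
Qed.
End Character.

Lemma almost_kernel_wave (R : realType) (g0 g1 : laurent2) (m : int)
    (xi chi : R[i]) (e : R) :
  `|xi| = 1 -> `|chi| = 1 -> laurent2_eval g0 xi chi = 0 ->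
  laurent2_eval g1 (xi * chi ^ m) chi = 0 -> 0 < e ->
  exists (phi : int -> R[i]) (w : R[i]), [/\ `|w| = 1, phi 0 = 1,
    forall a, `|phi a| <= 1 &
    forall a, `|phi (a + 1) * laurent2_eval g1 (w * chi ^ a) chi
               - phi a * laurent2_eval g0 (w * chi ^ a) chi| <= (e%:C)%C].
Proof.
move=> xi1 chi1 g00 g10 e0; have [K K0 KP] := laurent2_eval_perturb R g1.
have chi0 : chi != 0 by rewrite -normr_gt0 chi1.
have chiz k : `|chi ^ k| = 1 by exact: normrXz1.
(* [K + 1] instead of [K] avoids division by zero. *)
have eK : 0 < e / (K + 1) by rewrite divr_gt0// ltr_wpDl.
(* [N > |m|] makes [L = N - m] positive. *)
have [N mN chiN] := unit_circle_recurrence `|m|.+1 chi1 eK.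
have chiNV : `|chi ^ (- N%:Z) - 1| <= ((e / (K + 1))%:C)%C.
  rewrite -[leLHS]mulr1 -[X in _ * X <= _](chiz N) -normrM mulrBl mul1r -expfzDr// addNr expr0z.
  by rewrite distrC.
have [L mNL] : exists L : nat, L%:Z = N%:Z - m by exists `|N%:Z - m|%N; lia.
pose w := xi * chi ^ (m - N%:Z).
have w1 : `|w| = 1 by rewrite normrM xi1 chiz mul1r.
pose P (a : int) := laurent2_eval g1 (w * chi ^ a) chi.
pose Q (a : int) := laurent2_eval g0 (w * chi ^ a) chi.
have [|||phi [a0 [phi1 phile phiP]]] := @almost_recurrence_solution R P Q L e.
- lia.
- by rewrite /Q -mulrA -expfzDr// mNL subrKA subrr expr0z mulr1.
- rewrite /P expr0z mulr1 /w expfzDr// mulrA.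
  have xm1 : `|xi * chi ^ m| = 1 by rewrite normrM xi1 chiz mul1r.
  have := KP _ _ _ xm1 (chiz (- N%:Z)) chi1; rewrite g10 subr0 => /le_trans -> //.
  rewrite (le_trans (ler_wpM2l _ chiNV)) ?ler0c// -rmorphM lecR /=.
  by rewrite mulrCA ger_pMr// ler_pdivrMr ?mul1r ?lerDl// ltr_wpDl.
(* The index shift moving the maximum to 0 is absorbed by the factor [chi ^ a0] in [w]. *)
exists (fun a => phi (a + a0)), (w * chi ^ a0); split => //.
- by rewrite normrM w1 chiz mul1r.
- by rewrite add0r.
- by move=> a; rewrite -mulrA -expfzDr// [a0 + a]addrC addrAC; exact: phiP.
Qed.

Theorem theorem7p3 (R : realType) (f : grpring heisenberg) (g0 g1 : laurent2)
    (hf : f = laurent2_grpring g1 * grpring_elt hx - laurent2_grpring g0)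
    (hU : exists m : int,
       unitary_variety R g1 `&`
         [set (p.1 * p.2 ^ m, p.2) | p in unitary_variety R g0] !=set0)
    (d : principal_group R f -> principal_group R f -> R)
    (hd : invariant_metric d) :
  ~ expansive d (principal_action R f).
Proof.
have [m [p [[_ _ g10] [[xi chi] [/= xi1 chi1 g00] pE]]]] := hU.
rewrite -pE /= {p pE} in g10.
have [u [u1 u11 uker]] : exists v : heisenberg -> R, [/\ forall g, `|v g| <= 1,
    v 1%g = 1 & forall h, grp_pair f (fun g => v (h * g)%g) = 0].
  apply: almost_kernel_kernel => n.
  have n0 : 0 < n.+1%:R^-1 :> R by rewrite invr_gt0.
  have [phi [w [w1 phi0 phi1 phiP]]] :=
    almost_kernel_wave xi1 chi1 g00 g10 n0.
  have w0 : w != 0 by rewrite -normr_gt0 w1.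
  have chi0 : chi != 0 by rewrite -normr_gt0 chi1.
  (* The coefficients of [f] are integers, so real parts commute with the pairing; the value at the
     identity is [phi 0 = 1], already real. *)
  exists (@complex.Re R \o heis_wave phi w chi); split => [g||h].
  - rewrite -lecR (le_trans (normc_ge_Re _))// /heis_wave 2!normrM.
    by rewrite !normrXz1 ?mulr1.
  - by rewrite -heis1 /= /heis_wave !heis_entries phi0 !expr0z !mulr1.
  - have := grp_pair_comp (@complex.Re R) f (fun g => heis_wave phi w chi (h * g)%g).
    rewrite /comp => ->; rewrite -lecR (le_trans (normc_ge_Re _))//.
    rewrite hf grp_pair_heis_wave// normrM [X in X * _]normrM !normrXz1// !mul1r.
    exact: phiP.
by apply: bounded_kernel_nonexpansive (1%g) hd u1 _ uker; rewrite u11 oner_eq0.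
Qed.
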